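(* Let $N>M\ge1$ be integers and $0<P_1<1/2$. Among all $K_M$-passive permutations (the cooling-optimal permutations), the average work $$W(\pi)=\operatorname{Tr}\big[H_{\rm tot}(U_\pi\rho U_\pi^\dagger-\rho)\big]$$ is minimized by any $K_M$-passive permutation that, within each fixed target weight $w$, assigns the largest probabilities of that sector to the smallest ancillary excitation numbers. If $m_{k,w,a}$ denotes the number of shell-$k$ eigenvalues that such a permutation assigns to final target weight $w$ and final ancillary weight $a$, the minimum is $$\frac{W_{\rm perm}^{\min}}{\hbar\omega}=\sum_{k=0}^N\sum_{w=0}^M\sum_{a=0}^{N-M}m_{k,w,a}\,q_k\,(w+a)-NP_1 .$$
   Context: Setting: $N$ qubits with Hamiltonian $H_{\rm tot}=\sum_{i=1}^N\hbar\omega(|1\rangle\langle1|_i-\mathbb I_i/2)$, $\hbar\omega>0$; $P_0=1-P_1$; $\rho=\rho(P_1)=(P_0|0\rangle\langle 0|+P_1|1\rangle\langle 1|)^{\otimes N}$. A basis string with $k$ ones (shell $k$) has eigenvalue $q_k=P_0^{N-k}P_1^k$, strictly decreasing in $k$. The first $M$ qubits are the targets, the remaining $N-M$ are ancillary. The target weight (resp. ancillary weight, or ancillary excitation number) of a basis string is the number of ones among its first $M$ (resp. last $N-M$) bits. For a permutation $\pi$ of $\{0,1\}^N$, $U_\pi|b\rangle=|\pi(b)\rangle$. A permutation $\pi$ is $K_M$-passive if it places the eigenvalues of $\rho$, in nonincreasing order, on basis strings of nondecreasing target weight: if the target weight of $\pi(b)$ is strictly smaller than that of $\pi(b')$, then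 the eigenvalue of $\rho$ on $b$ is at least that on $b'$. Equivalently, $U_\pi$ minimizes $\operatorname{Tr}(\sum_{\alpha\le M}|1\rangle\langle1|_\alpha U\rho U^\dagger)$ over all unitaries $U$. *)

(* Defs.v *)
From HB Require Import structures.
From mathcomp Require Import all_boot all_order all_fingroup all_algebra.
From mathcomp Require Import reals complex.

Set Implicit Arguments.
Unset Strict Implicit.
Unset Printing Implicit Defensive.

Import Order.TTheory GRing.Theory Num.Theory.
Local Open Scope ring_scope.
Local Open Scope complex_scope.
Local Open Scope sesquilinear_scope.

(* Basis strings of N qubits. A bit is an element of 'I_2, so that it also
   indexes the rows and columns of a one-qubit operator. *)
Notation bits N := {ffun 'I_N -> 'I_2}.

(* The N-qubit space has dimension #|bits N| = 2 ^ N; the coordinate of the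
   string b is enum_rank b, and enum_val is the inverse correspondence. *)
Notation op R N := 'M[R[i]]_(#|{: bits N}|).

Section Strings.
Variable N : nat.
Implicit Types b : bits N.

Definition weight b : nat := #|[set i : 'I_N | b i == 1]|.

Definition targetWeight (M : nat) b : nat :=
  #|[set i : 'I_N | (i < M)%N & b i == 1]|.

Definition ancillaryWeight (M : nat) b : nat :=
  #|[set i : 'I_N | (M <= i)%N & b i == 1]|.

(* m_{k,w,a}: the shell-k eigenvalues of rho are indexed, with multiplicity,
   by the strings of weight k, and pi moves the one on b to pi b. *)
Definition shellCount (M : nat) (pi : {perm bits N}) (k w a : nat) : nat :=
  #|[set b : bits N | [&& weight b == k, targetWeight M (pi b) == w
                        & ancillaryWeight M (pi b) == a]]|.

End Strings.

Section Operators.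
Variables (R : realType) (N : nat).

(* The one-qubit operator |e><e|. *)
Definition proj1q (e : 'I_2) : 'M[R[i]]_2 := delta_mx e e.

(* A_0 (x) A_1 (x) ... (x) A_(N-1), given by its matrix entries. *)
Definition tensor (A : 'I_N -> 'M[R[i]]_2) : op R N :=
  \matrix_(x, y) \prod_(i < N) A i ((enum_val x : bits N) i) ((enum_val y : bits N) i).

(* A_i: the operator A on qubit i, the identity on the other qubits. *)
Definition local (i : 'I_N) (A : 'M[R[i]]_2) : op R N :=
  tensor (fun j => if j == i then A else 1%:M).

(* hw stands for the energy gap hbar * omega. *)
Definition Htot (hw : R) : op R N :=
  \sum_(i < N) hw%:C *: local i (proj1q 1 - 2%:R^-1 *: 1%:M).

Definition rho (P1 : R) : op R N :=
  tensor (fun _ => (1 - P1)%:C *: proj1q 0 + P1%:C *: proj1q 1).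

Definition ket (b : bits N) : 'cV[R[i]]_(#|{: bits N}|) :=
  delta_mx (enum_rank b) 0.

Definition Uperm (pi : {perm bits N}) : op R N :=
  \sum_(b : bits N) ket (pi b) *m (ket b)^t*.

Definition work (hw P1 : R) (pi : {perm bits N}) : R[i] :=
  \tr (Htot hw *m (Uperm pi *m rho P1 *m (Uperm pi)^t* - rho P1)).

(* q_k, the eigenvalue of rho on the strings of weight k; see rho_ket. *)
Definition q (P1 : R) (k : nat) : R := (1 - P1) ^+ (N - k) * P1 ^+ k.

Definition passive (M : nat) (P1 : R) (pi : {perm bits N}) : Prop :=
  forall b b' : bits N,
    (targetWeight M (pi b) < targetWeight M (pi b'))%N ->
    q P1 (weight b') <= q P1 (weight b).

(* Within each target sector, larger eigenvalues go to smaller ancillary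
   excitation numbers. *)
Definition sectorOrdered (M : nat) (P1 : R) (pi : {perm bits N}) : Prop :=
  forall b b' : bits N,
    targetWeight M (pi b) = targetWeight M (pi b') ->
    (ancillaryWeight M (pi b) < ancillaryWeight M (pi b'))%N ->
    q P1 (weight b') <= q P1 (weight b).

Lemma ket_conj (b : bits N) : (ket b)^t* = delta_mx 0 (enum_rank b).
Proof. by rewrite /ket trmx_delta map_delta_mx. Qed.

Lemma Uperm_ket (pi : {perm bits N}) (b : bits N) :
  Uperm pi *m ket b = ket (pi b).
Proof.
rewrite /Uperm mulmx_suml (bigD1 b) //= big1 => [|c neq_cb].
  by rewrite addr0 -mulmxA ket_conj mul_delta_mx -[RHS]mulmx1; congr (_ *m _);
     apply/matrixP=> i j; rewrite !mxE !ord1.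
rewrite -mulmxA ket_conj mul_delta_mx_0 ?mulmx0 //.
by apply: contraNneq neq_cb => /enum_rank_inj ->.
Qed.

Lemma rho_ket (P1 : R) (b : bits N) :
  rho P1 *m ket b = (q P1 (weight b))%:C *: ket b.
Proof.
have le_wN : (weight b <= N)%N.
  by rewrite -[X in (_ <= X)%N]card_ord; apply: max_card.
rewrite -colE; apply/matrixP=> x j; rewrite !mxE ord1 eqxx andbT enum_rankK.
have [->|neq_xb] := eqVneq x (enum_rank b); last first.
  rewrite mulr0; have: (enum_val x : bits N) != b.
    by apply: contraNneq neq_xb => <-; rewrite enum_valK.
  move=> neq; have [i neq_i] : exists i, (enum_val x : bits N) i != b i.
    apply/existsP; apply: contraNT neq => /existsPn eq_xb.
    by apply/eqP/ffunP=> i; apply/eqP; rewrite -[_ == _]negbK eq_xb.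
  rewrite (bigD1 i) //= !mxE.
  have -> : ((enum_val x : bits N) i == 0) && (b i == 0) = false.
    by apply/negP=> /andP[/eqP e /eqP e']; rewrite e e' eqxx in neq_i.
  have -> : ((enum_val x : bits N) i == 1) && (b i == 1) = false.
    by apply/negP=> /andP[/eqP e /eqP e']; rewrite e e' eqxx in neq_i.
  by rewrite !mulr0 addr0 mul0r.
rewrite mulr1 enum_rankK (bigID (fun i => b i == 1)) /=.
rewrite (eq_bigr (fun=> P1%:C)) => [|i /eqP bi]; last first.
  by rewrite !mxE bi /= mulr0 mulr1 add0r.
rewrite prodr_const [X in _ * X](eq_bigr (fun=> (1 - P1)%:C)) => [|i bi].
  rewrite prodr_const /q rmorphM !rmorphXn mulrC.
  have cE : #|(fun i : 'I_N => b i == 1)| = weight b.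
    by apply: eq_card => i; rewrite inE.
  rewrite cE; congr (_ ^+ _ * _).
  apply/eqP; rewrite -(eqn_add2l (weight b)) subnKC // -{1}cE.
  by rewrite -[X in _ == X]card_ord -(cardC (fun i : 'I_N => b i == 1)).
have -> : b i = 0 by case: (b i) bi => [[|[|]]] // ? _; apply: val_inj.
by rewrite !mxE /= mulr1 mulr0 addr0.
Qed.

End Operators.

(* Main.v *)
Require Import Defs.
From mathcomp Require Import all_boot all_order all_fingroup all_algebra.
From mathcomp Require Import reals complex ring.
Import Order.TTheory GRing.Theory Num.Theory.
Local Open Scope ring_scope.
Local Open Scope complex_scope.
Local Open Scope sesquilinear_scope.

(** Both conditions on [pi] together say that [pi] is antitone for the single
    lexicographic key [(N + 1) * target weight + ancillary weight].  By the
    rearrangement inequality [pi] then minimises the mean key over all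
    permutations, while every passive [sigma] minimises the mean target weight;
    subtracting, [pi] minimises the mean ancillary weight among passive
    permutations.  The work is affine in the sum of these two means. *)

(** * Rearrangement inequality over a finite type *)

Lemma ler_sum_card_eq (R : numFieldType) (T : finType) (A B : {set T})
    (f : T -> R) :
  #|A| = #|B| -> {in A & B, forall a b, f a <= f b} ->
  \sum_(a in A) f a <= \sum_(b in B) f b.
Proof.
move=> cAB leAB; have [A0|A_gt0] := posnP #|A|.
  by rewrite (cards0_eq A0) (cards0_eq (etrans (esym cAB) A0)).
have cA_gt0 : 0 < #|A|%:R :> R by rewrite ltr0n.
(* Multiplied by the common cardinality, both sides become sums over [A] times [B] and compare
   termwise. *)
rewrite -(ler_pM2r cA_gt0) !mulr_suml.
under eq_bigr do rewrite cAB mulr_natr -sumr_const.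
under [leRHS]eq_bigr do rewrite mulr_natr -sumr_const.
rewrite [leRHS]exchange_big /=.
by apply: ler_sum => a Aa; apply: ler_sum => b Bb; apply: leAB.
Qed.

(** Cancelling the intersection of [S] and [S'] leaves two differences of equal size, and every
    value on the first is at most every value on the second. *)
Lemma ler_sum_antitone_set {R : numFieldType} {T : finType} (S S' : {set T})
    (g : T -> R) :
  #|S| = #|S'| -> (forall b b', b \notin S -> b' \in S -> g b' <= g b) ->
  \sum_(b in S) g b <= \sum_(b in S') g b.
Proof.
move=> cS leS; rewrite (big_setID S') [leRHS](big_setID S) /= setIC lerD2l.
apply: ler_sum_card_eq => [|b' b].
  apply/eqP; rewrite -(eqn_add2l #|S' :&: S|) cardsID setIC.
  by rewrite cardsID cS.
by rewrite !inE => /andP[_ Sb'] /andP[nSb _]; apply: leS.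
Qed.

Lemma nat_layer_cake (n m : nat) :
  (m <= n)%N -> m = (\sum_(t < n) (t < m))%N.
Proof.
move=> le_mn; rewrite -(big_mkord xpredT (fun t => (t < m : nat))) /=.
rewrite (big_cat_nat (n := m)) //= [X in (_ + X)%N]big_nat_cond.
rewrite [X in (_ + X)%N]big1 => [|t /andP[/andP[le_mt _] _]]; last first.
  by rewrite ltnNge le_mt.
rewrite addn0 big_nat_cond (eq_bigr (fun=> 1%N)) => [|t /andP[/andP[_ ->]]] //.
by rewrite -big_nat_cond sum_nat_const_nat subn0 muln1.
Qed.

(** Layer cake: each side is the sum over thresholds [t] of the [g]-mass of a superlevel set.
    Permuting keeps the size of that set, and the superlevel sets of [f] itself carry the least mass
    for their size. *)
Lemma rearrangement_nat (R : numFieldType) (T : finType) (g : T -> R)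
    (f : T -> nat) (s : {perm T}) :
  (forall b b', (f b < f b')%N -> g b' <= g b) ->
  \sum_b g b * (f b)%:R <= \sum_b g b * (f (s b))%:R.
Proof.
move=> anti; pose n := (\max_b f b)%N.
have layer (h : T -> T) : \sum_b g b * (f (h b))%:R =
    \sum_(t < n) \sum_(b in [set b | (t < f (h b))%N]) g b.
  rewrite (eq_bigr (fun b => \sum_(t < n) g b * (t < f (h b))%:R)) => [|b _].
    rewrite exchange_big; apply: eq_bigr => t _; rewrite [RHS]big_mkcond /=.
    by apply: eq_bigr => b _; rewrite inE; case: ifP; rewrite ?mulr1 ?mulr0.
  rewrite -mulr_sumr -natr_sum -nat_layer_cake //.
  exact: (leq_bigmax (F := f) (h b)).
rewrite (layer id) (layer s); apply: ler_sum => t _.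
apply: ler_sum_antitone_set => [|b b']; last first.
  by rewrite !inE -leqNgt => le_bt lt_tb'; apply/anti/(leq_ltn_trans le_bt).
(* The superlevel set of [f] composed with [s] is the image under [s^-1] of that of [f]. *)
rewrite -(card_imset _ (@perm_inj _ s^-1)); apply: eq_card => b.
apply/imsetP/idP; last by rewrite inE => ltb; exists (s b); rewrite ?inE ?permK.
by case=> c; rewrite !inE => ltc ->; rewrite permKV.
Qed.

Lemma rearrangement_perm {R : numFieldType} {T : finType} (g : T -> R)
    (f : T -> nat) (p s : {perm T}) :
  (forall b b', (f (p b) < f (p b'))%N -> g b' <= g b) ->
  \sum_b g b * (f (p b))%:R <= \sum_b g b * (f (s b))%:R.
Proof.
move=> /(@rearrangement_nat R T g (f \o p) (s * p^-1)%g)/le_trans; apply.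
by apply: ler_sum => b _ /=; rewrite permM permKV.
Qed.

(** List [T] once sorted by [f] and once sorted by [g], and send each element to the one at the same
    position in the other list. *)
Lemma exists_monotone_perm (T : finType) (f g : T -> nat) :
  exists p : {perm T}, forall b b', (g (p b) < g (p b'))%N -> (f b <= f b')%N.
Proof.
pose srt h := sort (relpre h leq) (enum T).
have szS h : size (srt h) = #|T| by rewrite size_sort cardE.
have inS h b : b \in srt h by rewrite mem_sort mem_enum.
have unS h : uniq (srt h) by rewrite sort_uniq enum_uniq.
have tr (h : T -> nat) : transitive (relpre h leq).
  by move=> y x z; apply: leq_trans.
have leS h b b' : (index b (srt h) <= index b' (srt h))%N -> (h b <= h b')%N.
  move=> le_bb'.
  have sS : sorted (relpre h leq) (srt h).
    by apply: sort_sorted => x y; apply: leq_total.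
  have rS : reflexive (relpre h leq) by move=> x /=.
  have homo_nth := sorted_leq_nth (tr h) rS b sS.
  have lt_idx c : index c (srt h) \in [pred n | (n < size (srt h))%N].
    by rewrite inE index_mem inS.
  by have /= := homo_nth _ _ (lt_idx b) (lt_idx b') le_bb'; rewrite !nth_index.
(* Both lists have length [#|T|], so the default [b] is never returned. *)
pose F b := nth b (srt g) (index b (srt f)).
have idxF b : index (F b) (srt g) = index b (srt f).
  by rewrite index_uniq // szS -(szS f) index_mem.
have injF : injective F.
  move=> b b' eqF; have := idxF b; rewrite eqF idxF => eqi.
  by rewrite -(nth_index b (inS f b)) -eqi nth_index.
exists (perm injF) => b b'; rewrite !permE => ltg.
apply: (leS f); rewrite -!idxF leqNgt; apply: contraL ltg => lti.
by rewrite -leqNgt; apply/leS/ltnW.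
Qed.

(** * Target and ancillary weights, and their lexicographic key *)

Section Weights.
Variables (N M : nat).
Implicit Types b : bits N.

Lemma weight_le b : (weight b <= N)%N.
Proof. by rewrite -[leqRHS]card_ord; apply: max_card. Qed.

Lemma weight_split b : weight b = (targetWeight M b + ancillaryWeight M b)%N.
Proof.
rewrite /weight -(cardsID [set i : 'I_N | (i < M)%N]).
by congr addn; apply: eq_card => i; rewrite !inE [RHS]andbC // -leqNgt andbC.
Qed.

Lemma ancillaryWeight_leN b : (ancillaryWeight M b <= N)%N.
Proof. by rewrite -[leqRHS]card_ord; apply: max_card. Qed.

Lemma targetWeight_le b : (M <= N)%N -> (targetWeight M b <= M)%N.
Proof.
move=> leMN; have injw : injective (widen_ord leMN).
  by move=> i j [eq_ij]; apply: val_inj.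
rewrite -[leqRHS]card_ord -(card_imset _ injw).
apply/subset_leq_card/subsetP => i; rewrite inE => /andP[ltiM _].
by apply/imsetP; exists (Ordinal ltiM) => //; apply: val_inj.
Qed.

Lemma ancillaryWeight_le b : (M <= N)%N -> (ancillaryWeight M b <= N - M)%N.
Proof.
move=> leMN; have injw : injective (widen_ord leMN).
  by move=> i j [eq_ij]; apply: val_inj.
rewrite -(leq_add2r M) subnK //.
(* The complement of the ancillary positions contains a copy of ['I_M], which accounts for the added
   [M]. *)
rewrite -[leqRHS]card_ord -(cardsC [set i : 'I_N | (M <= i)%N]).
apply: leq_add.
  by apply/subset_leq_card/subsetP => i; rewrite !inE => /andP[].
rewrite -[leqLHS]card_ord -(card_imset _ injw).
apply/subset_leq_card/subsetP => i /imsetP[j _ ->].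
by rewrite !inE -ltnNge /=.
Qed.

(** The factor [N.+1] exceeds every ancillary weight, so the order of keys is lexicographic, while
    the mean key stays linear in the two mean weights. *)
Definition lexKey b : nat := (targetWeight M b * N.+1 + ancillaryWeight M b)%N.

Lemma lexKey_lt b b' : (lexKey b < lexKey b')%N =
  (targetWeight M b < targetWeight M b')%N ||
  (targetWeight M b == targetWeight M b') &&
    (ancillaryWeight M b < ancillaryWeight M b')%N.
Proof.
rewrite /lexKey; have := ancillaryWeight_leN b; have := ancillaryWeight_leN b'.
move: (targetWeight M b) (targetWeight M b') => t t'.
move: (ancillaryWeight M b) (ancillaryWeight M b') => a a' le_a' le_a.
have lt_lex u u' c c' : (u < u')%N -> (c <= N)%N ->
    (u * N.+1 + c < u' * N.+1 + c')%N.
  move=> ltu lec; apply: (@leq_trans (u.+1 * N.+1)).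
    by rewrite mulSn addnC ltn_add2r ltnS.
  by rewrite (leq_trans _ (leq_addr _ _)) // leq_mul2r ltu orbT.
case: (ltngtP t t') => [ltt|ltt|->]; first by rewrite lt_lex.
  by apply/negbTE; rewrite -leqNgt ltnW ?lt_lex.
by rewrite ltn_add2l.
Qed.

End Weights.

(** * Shell eigenvalues and mean weights *)

Section Energy.
Variables (R : realType) (N M : nat) (P1 : R).
Implicit Types (b : bits N) (p s : {perm bits N}).

Lemma q_antitone (k k' : nat) :
  0 <= P1 -> P1 <= 2%:R^-1 -> (k <= k')%N -> (k' <= N)%N ->
  q N P1 k' <= q N P1 k.
Proof.
move=> P_ge0 P_le lekk' lek'N.
have leP : P1 <= 1 - P1.
  by rewrite lerBrDr -mulr2n -mulr_natl mulrC -ler_pdivlMr ?ltr0n // div1r.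
have Q_ge0 := le_trans P_ge0 leP.
have eN : (N - k = (N - k') + (k' - k))%N by rewrite addnBA // subnK.
have eP : P1 ^+ k' = P1 ^+ (k' - k) * P1 ^+ k by rewrite -exprD subnK.
(* Without the common factors, what remains is to compare the powers [k' - k] of [P1] and
   [1 - P1]. *)
rewrite /q eP eN exprD mulrA ler_wpM2r ?exprn_ge0 // ler_wpM2l ?exprn_ge0 //.
by rewrite lerXn2r ?nnegrE.
Qed.

Lemma q_weight_prod b :
  q N P1 (weight b) = \prod_(i < N) (if b i == 1 then P1 else 1 - P1).
Proof.
rewrite big_if /= !prodr_const mulrC /q; congr (_ ^+ _ * _ ^+ _); last first.
  by apply: eq_card => i; rewrite inE.
rewrite -[X in (X - _)%N]card_ord -(cardsC [set i : 'I_N | b i == 1]) addKn.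
by apply: eq_card => i; rewrite !inE.
Qed.

Lemma weight_natr b : (weight b)%:R = \sum_(i < N) (b i == 1)%:R :> R.
Proof.
rewrite -natr_sum /weight -sum1_card big_mkcond /=; congr _%:R.
by apply: eq_bigr => i _; rewrite inE; case: (b i == 1).
Qed.

(** This is the binomial mean: the bits are independent and each is one with probability [P1]. *)
Lemma sum_q_weight :
  \sum_(b : bits N) q N P1 (weight b) * (weight b)%:R = N%:R * P1.
Proof.
pose F (j i : 'I_N) (x : 'I_2) : R :=
  (if x == 1 then P1 else 1 - P1) * (if i == j then (x == 1)%:R else 1).
transitivity (\sum_(j < N) \sum_(b : bits N) \prod_(i < N) F j i (b i)).
  rewrite exchange_big /=; apply: eq_bigr => b _.
  rewrite q_weight_prod weight_natr mulr_sumr; apply: eq_bigr => j _.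
  rewrite big_split /=; congr (_ * _).
  by rewrite (bigD1 j) //= eqxx big1 ?mulr1 // => i /negbTE ->.
rewrite (eq_bigr (fun=> P1)) => [|j _].
  by rewrite sumr_const card_ord mulr_natl.
(* The sum over strings factors into one-qubit sums: qubit [j] gives [P1], every other qubit gives
   1. *)
rewrite -(bigA_distr_bigA (F j)) /= (bigD1 j) //=.
rewrite [X in _ * X]big1 => [|i /negbTE ne_ij].
  by rewrite /F !big_ord_recl big_ord0 eqxx /= mulr0 !mulr1 add0r addr0.
by rewrite /F !big_ord_recl big_ord0 ne_ij /= !mulr1 addr0 subrK.
Qed.

(** Expectation of [f] in the permuted state, the eigenvalues of [rho] serving as probabilities. *)
Definition meanKey (f : bits N -> nat) p : R :=
  \sum_b q N P1 (weight b) * (f (p b))%:R.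

Lemma meanKey_weight p : meanKey (@weight N) p =
  meanKey (targetWeight M) p + meanKey (ancillaryWeight M) p.
Proof.
rewrite /meanKey -big_split /=; apply: eq_bigr => b _.
by rewrite (weight_split N M (p b)) natrD mulrDr.
Qed.

Lemma meanKey_lexKey p : meanKey (lexKey N M) p =
  meanKey (targetWeight M) p * N.+1%:R + meanKey (ancillaryWeight M) p.
Proof.
rewrite /meanKey mulr_suml -big_split /=; apply: eq_bigr => b _.
by rewrite /lexKey natrD natrM mulrDr mulrA.
Qed.

Lemma meanKey_weight_le p s :
  passive M P1 p -> sectorOrdered M P1 p -> passive M P1 s ->
  meanKey (@weight N) p <= meanKey (@weight N) s.
Proof.
move=> pasp ordp pass.
have le_ps : meanKey (targetWeight M) p <= meanKey (targetWeight M) s.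
  exact: rearrangement_perm.
(* Passivity of [s] makes it a minimiser as well, so the two mean target weights agree and cancel
   from the key inequality below. *)
have le_sp : meanKey (targetWeight M) s <= meanKey (targetWeight M) p.
  exact: rearrangement_perm.
have eq_t : meanKey (targetWeight M) p = meanKey (targetWeight M) s.
  by apply/eqP; rewrite eq_le le_ps.
have: meanKey (lexKey N M) p <= meanKey (lexKey N M) s.
  apply: rearrangement_perm => b b'; rewrite lexKey_lt.
  by case/orP=> [/pasp // | /andP[/eqP]]; apply: ordp.
by rewrite !meanKey_lexKey !meanKey_weight eq_t !lerD2l.
Qed.

(** * Work as a change of mean excitation number *)

Lemma Htot_diag (hw : R) b :
  Htot N hw (enum_rank b) (enum_rank b) =
  (hw * ((weight b)%:R - N%:R / 2%:R))%:C.
Proof.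
rewrite summxE weight_natr.
have -> : N%:R / 2%:R = \sum_(i < N) 2%:R^-1 :> R.
  by rewrite sumr_const card_ord mulr_natl.
rewrite -sumrB mulr_sumr rmorph_sum; apply: eq_bigr => i _.
rewrite !mxE enum_rankK (bigD1 i) //= eqxx big1 => [|j /negbTE ->].
  by rewrite !mxE eqxx andbb !mulr1 rmorphM rmorphB /= fmorphV !rmorph_nat.
by rewrite mxE eqxx.
Qed.

Lemma trace_mul_ket (A : op R N) b :
  \tr (A *m (ket R b *m (ket R b)^t*)) = A (enum_rank b) (enum_rank b).
Proof.
rewrite ket_conj mulmxA mxtrace_mulC -rowE /mxtrace big_ord1 mxE.
by rewrite -colE mxE.
Qed.

Lemma sum_ket_proj : \sum_(b : bits N) ket R b *m (ket R b)^t* = 1%:M.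
Proof.
apply/matrixP=> x y; rewrite summxE mxE (bigD1 (enum_val x)) //= big1.
  by rewrite ket_conj mul_delta_mx !mxE enum_valK eqxx addr0 eq_sym.
move=> b ne_bx; rewrite ket_conj mul_delta_mx mxE.
case: eqP => //= eqx; case/eqP: ne_bx.
by rewrite eqx enum_rankK.
Qed.

(** Inserting the resolution of the identity reduces this to the eigenvector equation [rho_ket]. *)
Lemma rho_spectral : rho N P1 =
  \sum_(b : bits N) (q N P1 (weight b))%:C *: (ket R b *m (ket R b)^t*).
Proof.
rewrite -[LHS]mulmx1 -sum_ket_proj mulmx_sumr; apply: eq_bigr => b _.
by rewrite mulmxA rho_ket scalemxAl.
Qed.

Lemma Uperm_rho p : Uperm R p *m rho N P1 *m (Uperm R p)^t* =
  \sum_(b : bits N) (q N P1 (weight b))%:C *: (ket R (p b) *m (ket R (p b))^t*).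
Proof.
rewrite rho_spectral mulmx_sumr mulmx_suml; apply: eq_bigr => b _.
rewrite -scalemxAr -scalemxAl -[in RHS]Uperm_ket; congr (_ *: _).
by rewrite trmx_mul map_mxM !mulmxA.
Qed.

Lemma work_meanKey (hw : R) p :
  work hw P1 p = (hw * (meanKey (@weight N) p - N%:R * P1))%:C.
Proof.
rewrite /work Uperm_rho rho_spectral -sumrB mulmx_sumr raddf_sum /=.
rewrite -sum_q_weight -sumrB mulr_sumr rmorph_sum; apply: eq_bigr => b _.
(* String by string, the zero-point energy [N / 2] cancels between [p b] and [b]. *)
rewrite -scalerBr -scalemxAr mxtraceZ mulmxBr raddfB /=.
by rewrite !trace_mul_ket !Htot_diag -rmorphB -rmorphM /=; congr _%:C; ring.
Qed.

(** * Shell counts and existence of an optimal permutation *)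

Lemma meanKey_shellCount p : (M <= N)%N ->
  meanKey (@weight N) p =
  \sum_(0 <= k < N.+1) \sum_(0 <= w < M.+1) \sum_(0 <= a < (N - M).+1)
     (shellCount M p k w a)%:R * q N P1 k * (w + a)%:R.
Proof.
move=> leMN; symmetry.
(* Each count is expanded into indicators over strings. Once the string sum is outermost, a single
   triple survives for each [b], and the weight bounds put it in range. *)
transitivity (\sum_(0 <= k < N.+1) \sum_(0 <= w < M.+1)
    \sum_(0 <= a < (N - M).+1) \sum_(b : bits N)
    if k == weight b then if w == targetWeight M (p b) then
      if a == ancillaryWeight M (p b) then q N P1 k * (w + a)%:R
      else 0 else 0 else 0).
  apply: eq_bigr => k _; apply: eq_bigr => w _; apply: eq_bigr => a _.
  rewrite -mulrA /shellCount -sum1_card natr_sum mulr_suml big_mkcond /=.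
  apply: eq_bigr => b _; rewrite inE mul1r [weight b == k]eq_sym.
  rewrite [targetWeight M (p b) == w]eq_sym.
  rewrite [ancillaryWeight M (p b) == a]eq_sym.
  by do 3! case: (_ == _).
under eq_bigr do under eq_bigr do rewrite exchange_big /=.
under eq_bigr do rewrite exchange_big /=.
rewrite exchange_big /=; apply: eq_bigr => b _.
rewrite (eq_bigr (fun k => if k == weight b then
  q N P1 k * (weight (p b))%:R else 0)) => [|k _].
  by rewrite -big_mkcond big_nat1_eq ltnS weight_le.
case: eqP => _; last by rewrite big1 // => w _; rewrite big1.
rewrite (eq_bigr (fun w => if w == targetWeight M (p b) then
  q N P1 k * (w + ancillaryWeight M (p b))%:R else 0)) => [|w _].
  by rewrite -big_mkcond big_nat1_eq ltnS targetWeight_le // -weight_split.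
case: eqP => _; last by rewrite big1.
by rewrite -big_mkcond big_nat1_eq ltnS ancillaryWeight_le.
Qed.

(** Matching strings sorted by shell with strings sorted by [lexKey] gives both orderings, because
    [q] decreases with the shell. *)
Lemma exists_sectorOrdered : 0 <= P1 -> P1 <= 2%:R^-1 ->
  exists p, passive M P1 p /\ sectorOrdered M P1 p.
Proof.
move=> P_ge0 P_le.
have [p leP] := @exists_monotone_perm (bits N) (@weight N) (lexKey N M).
exists p; split=> b b' => [ltt|eqt lta]; apply: q_antitone;
  by rewrite ?weight_le // leP // lexKey_lt ?ltt // eqt eqxx lta orbT.
Qed.

End Energy.

Theorem mainTheorem11 (R : realType) (N M : nat) (hw P1 : R)
    (M_ge1 : (1 <= M)%N) (M_ltN : (M < N)%N)
    (hw_gt0 : 0 < hw) (P1_gt0 : 0 < P1) (P1_lt : P1 < 2%:R^-1) :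
  (exists pi : {perm bits N}, passive M P1 pi /\ sectorOrdered M P1 pi) /\
  (forall pi : {perm bits N}, passive M P1 pi -> sectorOrdered M P1 pi ->
    (forall sigma : {perm bits N}, passive M P1 sigma ->
       work hw P1 pi <= work hw P1 sigma) /\
    work hw P1 pi / hw%:C =
      (\sum_(0 <= k < N.+1) \sum_(0 <= w < M.+1) \sum_(0 <= a < (N - M).+1)
          (shellCount M pi k w a)%:R * q N P1 k * (w + a)%:R
        - N%:R * P1)%:C).
Proof.
have P1_ge0 := ltW P1_gt0; have P1_le := ltW P1_lt.
split=> [|pi pas_pi ord_pi]; first exact: exists_sectorOrdered.
split=> [sigma pas_sigma|].
  (* Both works are embedded reals, so the order on [R[i]] reduces to the real one. *)
  by rewrite !work_meanKey lecR ler_pM2l // lerB // (meanKey_weight_le _ _ M).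
rewrite -(meanKey_shellCount _ _ _ _ _ (ltnW M_ltN)) work_meanKey.
have hw_neq0 : hw%:C != 0 by rewrite fmorph_eq0 gt_eqF.
by rewrite rmorphM /= mulrC mulKf.
Qed.
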